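(* Let $\mathcal K$ be a complete idempotent reflexive semiring, and let $V$ be a complete subsemimodule of a complete right $\mathcal K$-semimodule $X$. Then any continuous linear form defined on $V$ (i.e. any linear continuous map $V\to\mathcal K$) extends to a continuous linear form on $X$.
   Context: A semiring $(\mathcal K,\oplus,\otimes,\varepsilon,e)$ is idempotent if $a\oplus a=a$ for all $a$. An idempotent commutative monoid carries the natural order $a\le b\iff a\oplus b=b$. An ordered set is complete if every subset $U$ has a least upper bound $\bigvee U$. A map $f$ between complete ordered sets is continuous if $f(\bigvee U)=\bigvee f(U)$ for every subset $U$ (including $U=\varnothing$). An idempotent semiring is complete if it is complete for its natural order and all its left and right multiplications are continuous. A right $\mathcal K$-semimodule is a commutative monoid $(X,\oplus,\varepsilon)$ with a right action satisfying $x(\lambda\mu)=(x\lambda)\mu$, $(x\oplus y)\lambda=x\lambda\oplus y\lambda$, $x(\lambda\oplus\mu)=x\lambda\oplus x\mu$, $x\varepsilon=\varepsilon$, $xe=x$; its addition is then idempotent. It is complete if it is complete for its natural order and the maps $x\mapsto x\lambda$ on $X$ and $\mu\mapsto v\mu$ from $\mathcal K$ to $X$ are all continuous. A map is linear if it preserves finite sums and commutes with the action. A complete subsemimodule of $X$ is a subset stable under arbitrary suprema (of $X$) and under the action of scalars. For $\lambda,\varphi\in\mathcal K$: $\lambda\backslash\varphi=\max\{\mu\in\mathcal K\mid\lambda\mu\le\varphi\}$ and $\varphi/\lambda=\max\{\mu\in\mathcal K\mid\mu\lambda\le\varphi\}$. $\mathcal K$ is reflexive, with distinguished element $\varphi\in\mathcal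 K$, if $\varphi/(\lambda\backslash\varphi)=\lambda$ (left reflexive) and $(\varphi/\lambda)\backslash\varphi=\lambda$ (right reflexive) for all $\lambda\in\mathcal K$. *)

(* Defs.v *)
From HB Require Import structures.
From mathcomp Require Import all_boot all_algebra.
From mathcomp Require Import boolp classical_sets.
Set Implicit Arguments.
Unset Strict Implicit.
Unset Printing Implicit Defensive.
Import GRing.Theory.
Local Open Scope classical_set_scope.
Local Open Scope ring_scope.

Reserved Notation "x '<=n' y" (at level 70, no associativity).

Section NaturalOrder.
Context {M : nmodType}.
Implicit Types (U : set M) (x y s m : M).

Definition natle x y : Prop := x + y = y.

Local Notation "x <=n y" := (natle x y).

Definition is_natlub U s : Prop :=
  (forall x, U x -> x <=n s) /\
  (forall y, (forall x, U x -> x <=n y) -> s <=n y).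

Definition is_natmax U m : Prop := U m /\ (forall x, U x -> x <=n m).

(* The fallback value 0 is irrelevant whenever the bound exists. *)
Definition natsup U : M := xget 0 [set s | is_natlub U s].
Definition natmax U : M := xget 0 [set m | is_natmax U m].

Lemma natle_anti x y : x <=n y -> y <=n x -> x = y.
Proof. by rewrite /natle => xy yx; rewrite -[LHS]yx addrC. Qed.

Lemma natle_trans x y z : x <=n y -> y <=n z -> x <=n z.
Proof. by rewrite /natle => xy yz; rewrite -yz addrA xy. Qed.

Lemma natsup_unique U s : is_natlub U s -> natsup U = s.
Proof.
move=> [ubs leasts]; apply: xget_unique => // t [ubt leastt].
by apply: natle_anti; [exact: leastt | exact: leasts].
Qed.

Lemma natmax_unique U m : is_natmax U m -> natmax U = m.
Proof.
move=> [Um ubm]; apply: xget_unique => // t [Ut ubt].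
by apply: natle_anti; [exact: ubm | exact: ubt].
Qed.

End NaturalOrder.

Notation "x <=n y" := (natle x y).

Definition natcomplete (M : nmodType) : Prop :=
  forall U : set M, exists s, is_natlub U s.

Definition sup_continuous (M N : nmodType) (f : M -> N) : Prop :=
  forall U : set M, f (natsup U) = natsup (f @` U).

HB.mixin Record PzSemiRing_isCompleteIdempotent K of GRing.PzSemiRing K := {
  addii : forall a : K, a + a = a;
  natcomplete_semiring : natcomplete K;
  mull_sup_continuous : forall a : K, sup_continuous (fun b : K => a * b);
  mulr_sup_continuous : forall a : K, sup_continuous (fun b : K => b * a)
}.

#[short(type="completeSemiRingType")]
HB.structure Definition CompleteSemiRing :=
  {K of GRing.PzSemiRing K & PzSemiRing_isCompleteIdempotent K}.

(* A right K-semimodule is a left semimodule over the converse semiring K^c: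
   the axiom a *: (b *: x) = (a * b) *: x over K^c reads (x b) a = x (b a). *)
Notation "x *r a" := ((a : (_)^c%type) *: x)
  (at level 40, left associativity, only parsing) : ring_scope.

HB.mixin Record RSemiModule_isComplete (K : completeSemiRingType) X
    of GRing.LSemiModule K^c X := {
  natcomplete_semimod : natcomplete X;
  actl_sup_continuous : forall a : K, sup_continuous (fun x : X => x *r a);
  actr_sup_continuous : forall x : X, sup_continuous (fun a : K => x *r a)
}.

#[short(type="completeRSemiModType")]
HB.structure Definition CompleteRSemiModule (K : completeSemiRingType) :=
  {X of GRing.LSemiModule K^c X & RSemiModule_isComplete K X}.

Section CompleteTheory.
Context {K : completeSemiRingType} {X : completeRSemiModType K}.

Lemma natsupP_semiring (U : set K) : is_natlub U (natsup U).
Proof. by have [s Us] := natcomplete_semiring U; rewrite (natsup_unique Us). Qed.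

Lemma natsupP (U : set X) : is_natlub U (natsup U).
Proof. by have [s Us] := natcomplete_semimod U; rewrite (natsup_unique Us). Qed.

Lemma addii_semimod (x : X) : x + x = x.
Proof.
have := scalerDl x (1 : K^c) 1; rewrite scale1r => <-.
by rewrite [1 + 1](addii (1 : K)) scale1r.
Qed.

Lemma natsup0 : natsup (set0 : set X) = 0.
Proof. by apply: natsup_unique; split=> // y _; rewrite /natle add0r. Qed.

Lemma natsup2 (x y : X) : natsup [set x; y] = x + y.
Proof.
apply: natsup_unique; split=> [z [->|->]|z ubz]; rewrite /natle.
- by rewrite addrA addii_semimod.
- by rewrite addrCA addii_semimod.
- by rewrite -addrA (ubz y) ?(ubz x) //=; [left | right].
Qed.

End CompleteTheory.

Section Residuation.
Context {K : completeSemiRingType}.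
Implicit Types a c phi : K.

Definition ldiv a c : K := natmax [set m | a * m <=n c].
Definition rdiv c a : K := natmax [set m | m * a <=n c].

Lemma ldivP a c : is_natmax [set m | a * m <=n c] (ldiv a c).
Proof.
set S := [set m | a * m <=n c]; have [ubS leastS] := natsupP_semiring S.
suff Smax : is_natmax S (natsup S) by rewrite /ldiv (natmax_unique Smax).
split=> //; rewrite /S /= mull_sup_continuous.
have [_] := natsupP_semiring ((fun b => a * b) @` S); apply.
by move=> _ [m Sm <-].
Qed.

Lemma rdivP c a : is_natmax [set m | m * a <=n c] (rdiv c a).
Proof.
set S := [set m | m * a <=n c]; have [ubS leastS] := natsupP_semiring S.
suff Smax : is_natmax S (natsup S) by rewrite /rdiv (natmax_unique Smax).
split=> //; rewrite /S /= mulr_sup_continuous.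
have [_] := natsupP_semiring ((fun b => b * a) @` S); apply.
by move=> _ [m Sm <-].
Qed.

Definition left_reflexive_at phi : Prop :=
  forall a, rdiv phi (ldiv a phi) = a.
Definition right_reflexive_at phi : Prop :=
  forall a, ldiv (rdiv phi a) phi = a.
Definition reflexive_semiring_at phi : Prop :=
  left_reflexive_at phi /\ right_reflexive_at phi.

End Residuation.

Section Subsemimodule.
Context {K : completeSemiRingType} {X : completeRSemiModType K}.

Definition complete_subsemimodule (V : set X) : Prop :=
  (forall U : set X, U `<=` V -> V (natsup U)) /\
  (forall (x : X) (a : K), V x -> V (x *r a)).

(* The points of V; the proof is a parameter so that the semimodule structure
   below can be inferred from the type. *)
Definition csub (V : set X) (hV : complete_subsemimodule V) : Type :=
  {x : X | x \in V}.

Context (V : set X) (hV : complete_subsemimodule V).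

HB.instance Definition _ := [isSub of csub hV for @proj1_sig X _].
HB.instance Definition _ := [Choice of csub hV by <:].

Fact csub_closed : subsemimod_closed (fun x : X => x \in V).
Proof.
have [Vsup Vact] := hV; split; first split.
- by apply/mem_set; rewrite -natsup0; apply: Vsup => x.
- move=> x y /set_mem Vx /set_mem Vy; apply/mem_set; rewrite -natsup2.
  by apply: Vsup => z [->|->].
- by move=> a x /set_mem Vx; apply/mem_set; exact: Vact.
Qed.

HB.instance Definition _ :=
  GRing.SubChoice_isSubLSemiModule.Build K^c X (fun x => x \in V) (csub hV)
    csub_closed.

Lemma val_natle (x y : csub hV) : (val x <=n val y) <-> (x <=n y).
Proof.
by rewrite /natle -raddfD; split=> [/val_inj | ->].
Qed.

Lemma csub_lub (U : set (csub hV)) :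
  exists2 s, is_natlub U s & val s = natsup (val @` U).
Proof.
have [ubU leastU] := natsupP (val @` U).
have Vs : natsup (val @` U) \in V.
  by apply/mem_set; apply: hV.1 => _ [x _ <-]; apply/set_mem; exact: valP.
exists (Sub (natsup (val @` U)) Vs); last by rewrite SubK.
split=> [x Ux | y uby]; apply/val_natle; rewrite SubK.
  by apply: ubU; exists x.
by apply: leastU => _ [x Ux <-]; apply/val_natle/uby.
Qed.

Lemma val_natsup (U : set (csub hV)) : val (natsup U) = natsup (val @` U).
Proof. by have [s /natsup_unique ->] := csub_lub U. Qed.

Fact csub_complete : natcomplete (csub hV).
Proof. by move=> U; have [s Us _] := csub_lub U; exists s. Qed.

Fact csub_actl (a : K) : sup_continuous (fun x : csub hV => x *r a).
Proof.
move=> U; apply: val_inj; rewrite [RHS]val_natsup [LHS]linearZ_LR /= val_natsup.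
rewrite actl_sup_continuous !image_comp; congr natsup.
Qed.

Fact csub_actr (x : csub hV) : sup_continuous (fun a : K => x *r a).
Proof.
move=> U; apply: val_inj; rewrite [RHS]val_natsup [LHS]linearZ_LR /=.
rewrite actr_sup_continuous !image_comp; congr natsup.
Qed.

HB.instance Definition _ :=
  RSemiModule_isComplete.Build K (csub hV) csub_complete csub_actl csub_actr.

End Subsemimodule.

(* K as a right semimodule over itself: here x *r a is the product x * a of K.
   The tag ^o on K^c carries the scaling a *: x = (a * x in K^c) = (x * a in K). *)
Notation rself K := ((K^c)^o)%type.

HB.instance Definition _ (K : completeSemiRingType) :=
  RSemiModule_isComplete.Build K (rself K)
    natcomplete_semiring mulr_sup_continuous mull_sup_continuous.

(* Main.v *)
Require Import Defs.
From HB Require Import structures.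
From mathcomp Require Import all_boot all_algebra.
From mathcomp Require Import boolp classical_sets.
Set Implicit Arguments.
Unset Strict Implicit.
Unset Printing Implicit Defensive.
Import GRing.Theory.
Local Open Scope classical_set_scope.
Local Open Scope ring_scope.

(** Let w be the largest point of V with f w <= phi. For v in V and b in K one
    has v b <= w iff f(v) b <= phi, that is, v \ w = f(v) \ phi, so left
    reflexivity gives f(v) = phi / (v \ w). The right-hand side makes sense for
    every point of X and defines the extension g. Since a |-> a \ phi and
    b |-> phi / b are mutually inverse antitone bijections, g is characterized
    by: g x <= a iff x (a \ phi) <= w. *)

Section Residuation.
Context {K : completeSemiRingType}.
Implicit Types a b c : K.

Lemma natle_mul2r a b c : a <=n b -> a * c <=n b * c.
Proof. by rewrite /natle -mulrDl => ->. Qed.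

Lemma natle_mul2l a b c : a <=n b -> c * a <=n c * b.
Proof. by rewrite /natle -mulrDr => ->. Qed.

Lemma natle_ldiv a b c : b <=n ldiv a c <-> a * b <=n c.
Proof.
have [ac leac] := ldivP a c; split=> [/(natle_mul2l a) le_b|/leac//].
exact: natle_trans le_b ac.
Qed.

Lemma natle_rdiv a b c : b <=n rdiv c a <-> b * a <=n c.
Proof.
have [ac leac] := rdivP c a; split=> [/(natle_mul2r a) le_b|/leac//].
exact: natle_trans le_b ac.
Qed.

Lemma natle_eq a b : (forall c, c <=n a <-> c <=n b) -> a = b.
Proof.
by move=> ab; apply: natle_anti; [apply/ab | apply/ab]; exact: addii.
Qed.

Lemma natge_eq a b : (forall c, a <=n c <-> b <=n c) -> a = b.
Proof.
by move=> ab; apply: natle_anti; [apply/ab | apply/ab]; exact: addii.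
Qed.

Lemma rdiv_rdiv a b c : rdiv (rdiv c b) a = rdiv c (a * b).
Proof.
apply: natle_eq => d; split=> [/natle_rdiv/natle_rdiv|/natle_rdiv] le_d.
  by apply/natle_rdiv; rewrite mulrA.
by do 2!apply/natle_rdiv; rewrite -mulrA.
Qed.

Context (phi : K) (hphi : reflexive_semiring_at phi).

(** Left reflexivity writes b as phi / (b \ phi), hence b / a = phi / (a (b \ phi)), and right
    reflexivity cancels the outer division. This is what makes the extension commute with
    scalars. *)
Lemma ldiv_rdiv a b : ldiv (rdiv b a) phi = a * ldiv b phi.
Proof. by rewrite -{1}[b]hphi.1 rdiv_rdiv hphi.2. Qed.

(** Residuation alone gives the Galois connection with both inequalities reversed. Reflexivity makes
    the two antitone maps mutually inverse, so the equivalence also holds in this direction. *)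
Lemma rdiv_natle a b : rdiv phi b <=n a <-> ldiv a phi <=n b.
Proof.
split=> le_ab.
  rewrite -[b]hphi.2; apply/natle_ldiv.
  apply: natle_trans (ldivP a phi).1; exact: natle_mul2r.
rewrite -[a]hphi.1; apply/natle_rdiv.
apply: natle_trans (rdivP phi b).1; exact: natle_mul2l.
Qed.

End Residuation.

Section Action.
Context {K : completeSemiRingType} {X : completeRSemiModType K}.
Implicit Types (x y w : X) (a b : K).

Lemma natle_act2r x y a : x <=n y -> x *r a <=n y *r a.
Proof. by rewrite /natle -scalerDr => ->. Qed.

Lemma natle_act2l x a b : a <=n b -> x *r a <=n x *r b.
Proof. by rewrite /natle -scalerDl => ab; congr (_ *: _). Qed.

Lemma act_mul x a b : x *r (a * b) = x *r a *r b.
Proof. by rewrite scalerA. Qed.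

Lemma natsup_act_natle (U : set X) a w :
  natsup U *r a <=n w <-> forall x, U x -> x *r a <=n w.
Proof.
split=> [leUw x Ux|leUw].
  by apply: natle_trans leUw; apply: natle_act2r; apply: (natsupP U).1.
rewrite actl_sup_continuous.
by apply: (natsupP ((fun x : X => x *r a) @` U)).2 => _ [x Ux <-]; exact: leUw.
Qed.

Definition act_ldiv x w : K := natsup [set a | x *r a <=n w].

(** Continuity of the action in the scalar puts the supremum in the set it bounds, so [act_ldiv x w]
    is a maximum: the residual x \ w. *)
Lemma natle_act_ldiv x w a : a <=n act_ldiv x w <-> x *r a <=n w.
Proof.
split=> [/(natle_act2l x) lea|xa_w]; last exact: (natsupP_semiring _).1.
apply: natle_trans lea _; rewrite /act_ldiv actr_sup_continuous.
set U := (X in natsup X); apply: (natsupP U).2.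
by move=> _ [b xb_w <-].
Qed.

End Action.

Section LinearForm.
Context {K : completeSemiRingType} (phi : K).
Context (hphi : reflexive_semiring_at phi) {X : completeRSemiModType K}.

Definition polar_form (w x : X) : rself K := rdiv phi (act_ldiv x w).

Lemma polar_form_natle w x (a : K) :
  (polar_form w x : K) <=n a <-> x *r ldiv a phi <=n w.
Proof.
by split=> [/(rdiv_natle hphi)/natle_act_ldiv|
            /natle_act_ldiv/(rdiv_natle hphi)].
Qed.

(** Right multiplication by a \ phi commutes with suprema, so [polar_form w (natsup U)] has the same
    upper bounds a as the family of values on [U]. *)
Lemma polar_form_sup_continuous w : sup_continuous (polar_form w).
Proof.
move=> U; apply/esym/natsup_unique; split=> [_ [x Ux <-]|a ub_a].
  apply/polar_form_natle; move: x Ux; apply/natsup_act_natle.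
  by apply/polar_form_natle; exact: addii.
apply/polar_form_natle/natsup_act_natle => x Ux.
by apply/polar_form_natle; apply: ub_a; exists x.
Qed.

Lemma polar_form_semilinear w : semilinear (polar_form w).
Proof.
split=> [a x|x y].
  (* Upper bounds c are compared: a value times a is below c iff the value is below c / a, and (c /
     a) \ phi = a (c \ phi). *)
  apply: (@natge_eq K) => c; split=> [/polar_form_natle le_c|].
    apply/natle_rdiv/polar_form_natle.
    by rewrite (ldiv_rdiv hphi) act_mul.
  move=> /natle_rdiv/polar_form_natle le_c; apply/polar_form_natle.
  by rewrite -act_mul -(ldiv_rdiv hphi).
(* Additivity is continuity on the pair {x, y}. *)
rewrite -!natsup2 polar_form_sup_continuous; congr natsup.
by rewrite image_setU !image_set1.
Qed.

End LinearForm.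

Theorem corollary40 (K : completeSemiRingType) (phi : K)
    (hphi : reflexive_semiring_at phi)
    (X : completeRSemiModType K) (V : set X) (hV : complete_subsemimodule V)
    (f : {linear csub hV -> rself K}) (hf : sup_continuous f) :
  exists g : {linear X -> rself K},
    sup_continuous g /\ forall v : csub hV, g (val v) = f v.
Proof.
pose W : set (csub hV) := [set v | (f v : K) <=n phi].
have leW (v : csub hV) (b : K) :
    (f v : K) * b <=n phi <-> val v *r b <=n val (natsup W).
  have <- : f (v *r b) = (f v : K) * b by rewrite linearZ.
  have -> : val v *r b = val (v *r b) by [].
  rewrite val_natle; split=> [fvb|/(congr1 f)].
    exact: (natsupP W).1.
  rewrite linearD => fvb; apply: natle_trans fvb _.
  (* By continuity, f maps the supremum of [W] to a supremum of elements below phi, so that supremum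
     lies in [W]. *)
  rewrite hf; apply: (natsupP_semiring (f @` W)).2 => _ [u Wu <-]; exact: Wu.
pose w := val (natsup W).
pose glin := GRing.isSemilinear.Build K^c X (rself K) *:%R (polar_form phi w)
  (polar_form_semilinear hphi w).
pose g : {linear X -> rself K} := HB.pack (polar_form phi w) glin.
exists g; split; first exact: polar_form_sup_continuous.
move=> v; rewrite -[f v]hphi.1; apply: (congr1 (rdiv phi)).
apply: natle_eq => b; split=> [/natle_act_ldiv/leW le_b|/natle_ldiv/leW le_b].
  exact/natle_ldiv.
exact/natle_act_ldiv.
Qed.
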